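(* Let $n,r,s\geq 1$ be integers and $d=\gcd(r,n,s)$. (a) If $s\neq r$ then $H(r,n,s)^{\mathrm{ab}}$ is free abelian if and only if $|r-s|=d$ and either $r\equiv 0\bmod n$ or $s\equiv 0\bmod n$, in which case $H(r,n,s)$ is free of rank $d-1$. (b) If $s=r$ then $H(r,n,s)^{\mathrm{ab}}$ is free abelian if and only if either (i) $n\mid r$, in which case $H(r,n,s)$ is free of rank $n$; or (ii) $d=1$, in which case $H(r,n,s)$ is isomorphic to the fundamental group of (the complement of) the $(r,n)$ torus knot.
   Context: For integers $n,r,s\geq 1$, the generalized Fibonacci group $H(r,n,s)$ is the group with presentation \[H(r,n,s)=\left\langle x_0,\ldots,x_{n-1}\ \middle|\ \prod_{j=0}^{r-1}x_{i+j}=\prod_{j=0}^{s-1}x_{i+j+r}\ (0\leq i<n)\right\rangle,\] where subscripts are taken modulo $n$ and products are taken in order of increasing $j$. $G^{\mathrm{ab}}$ denotes the abelianisation of $G$. The trivial group counts as free (and free abelian) of rank $0$. For coprime $r,n\geq 1$ the fundamental group of the $(r,n)$ torus knot is $\langle a,b\mid a^r=b^n\rangle$. *)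

(* Defs.v *)
From HB Require Import structures.
From mathcomp Require Import all_boot all_order all_algebra all_fingroup.
From mathcomp Require Import generic_quotient boolp.
From mathcomp.multinomials Require Import freeg.

Set Implicit Arguments.
Unset Strict Implicit.
Unset Printing Implicit Defensive.

Local Open Scope quotient_scope.
Local Open Scope group_scope.

(* Here groups are the (possibly infinite) [groupType]s of boot/monoid.v,     *)
(* not the finite groups of fingroup.                                         *)
Definition isomorphic (G H : groupType) : Prop :=
  exists f : {multiplicative G -> H}, bijective f.

Section FreeGroup.
Variable I : choiceType.

(* The letter (i, false) stands for the generator i, (i, true) for i^-1.      *)
Definition word := seq (I * bool).

Inductive word_eq : word -> word -> Prop :=
| word_eq_refl u : word_eq u u
| word_eq_sym u v : word_eq u v -> word_eq v u
| word_eq_trans u v w : word_eq u v -> word_eq v w -> word_eq u w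
| word_eq_cat u u' v v' :
    word_eq u u' -> word_eq v v' -> word_eq (u ++ v) (u' ++ v')
| word_eq_cancel i b : word_eq [:: (i, b); (i, ~~ b)] [::].

Definition word_eqb (u v : word) : bool := `[< word_eq u v >].

Lemma word_eqb_refl : reflexive word_eqb.
Proof. by move=> u; apply/asboolP; exact: word_eq_refl. Qed.

Lemma word_eqb_sym : symmetric word_eqb.
Proof.
by move=> u v; apply/asboolP/asboolP => uv; exact: word_eq_sym.
Qed.

Lemma word_eqb_trans : transitive word_eqb.
Proof.
move=> v u w /asboolP uv /asboolP vw; apply/asboolP.
exact: word_eq_trans uv vw.
Qed.

Canonical word_equiv :=
  EquivRel word_eqb word_eqb_refl word_eqb_sym word_eqb_trans.

Definition free_group := {eq_quot word_eqb}.

HB.instance Definition _ := Choice.on free_group.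
HB.instance Definition _ := EqQuotient.on free_group.

Definition word_inv (u : word) : word := rev [seq (a.1, ~~ a.2) | a <- u].

Lemma word_invK : involutive word_inv.
Proof.
move=> u; rewrite /word_inv map_rev revK -map_comp map_id_in //.
by move=> [i b] _ /=; rewrite negbK.
Qed.

Lemma word_inv_cat u v : word_inv (u ++ v) = word_inv v ++ word_inv u.
Proof. by rewrite /word_inv map_cat rev_cat. Qed.

Lemma word_eq_inv u v : word_eq u v -> word_eq (word_inv u) (word_inv v).
Proof.
elim=> [{}u|{}u {}v _|{}u {}v w _ uv _ vw|u1 u2 v1 v2 _ u12 _ v12|i b].
- exact: word_eq_refl.
- exact: word_eq_sym.
- exact: word_eq_trans uv vw.
- by rewrite !word_inv_cat; exact: word_eq_cat.
- by rewrite /word_inv /= /rev /= negbK; exact: word_eq_cancel.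
Qed.

Lemma word_eq_mulVw u : word_eq (word_inv u ++ u) [::].
Proof.
elim: u => [|[i b] u IH]; first exact: word_eq_refl.
rewrite -cat1s word_inv_cat -catA [_ ++ (_ ++ u)]catA.
apply: word_eq_trans IH; apply: word_eq_cat; first exact: word_eq_refl.
rewrite -[X in word_eq _ X]cat0s; apply: word_eq_cat; last exact: word_eq_refl.
by rewrite -[X in _ ++ [:: (i, X)]]negbK; exact: word_eq_cancel.
Qed.

Definition free_one : free_group := \pi_free_group [::].
Definition free_mul (x y : free_group) : free_group :=
  \pi_free_group (repr x ++ repr y).
Definition free_inv (x : free_group) : free_group :=
  \pi_free_group (word_inv (repr x)).

Lemma free_piP u v : \pi_free_group u = \pi_free_group v <-> word_eq u v.
Proof. by split=> [/eqmodP/asboolP | uv] //; apply/eqmodP/asboolP. Qed.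

Lemma free_repr u : word_eq (repr (\pi_free_group u)) u.
Proof. by apply/free_piP; rewrite reprK. Qed.

Lemma free_mul_pi u v :
  free_mul (\pi_free_group u) (\pi_free_group v) = \pi_free_group (u ++ v).
Proof. by apply/free_piP; apply: word_eq_cat; exact: free_repr. Qed.

Lemma free_inv_pi u :
  free_inv (\pi_free_group u) = \pi_free_group (word_inv u).
Proof. by apply/free_piP; apply: word_eq_inv; exact: free_repr. Qed.

Fact free_mulA : associative free_mul.
Proof.
move=> x y z; elim/quotW: x => u; elim/quotW: y => v; elim/quotW: z => w.
by rewrite (free_mul_pi u v) (free_mul_pi v w) !free_mul_pi catA.
Qed.

Fact free_mul1 : left_id free_one free_mul.
Proof. by move=> x; elim/quotW: x => u; rewrite free_mul_pi. Qed.

Fact free_mulr1 : right_id free_one free_mul.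
Proof. by move=> x; elim/quotW: x => u; rewrite free_mul_pi cats0. Qed.

Fact free_mulV : left_inverse free_one free_inv free_mul.
Proof.
move=> x; elim/quotW: x => u; rewrite free_inv_pi free_mul_pi.
by apply/free_piP; exact: word_eq_mulVw.
Qed.

Fact free_mulrV : right_inverse free_one free_inv free_mul.
Proof.
move=> x; elim/quotW: x => u; rewrite free_inv_pi free_mul_pi.
by apply/free_piP; rewrite -{1}[u]word_invK; exact: word_eq_mulVw.
Qed.

HB.instance Definition _ := isGroup.Build free_group
  free_mulA free_mul1 free_mulr1 free_mulV free_mulrV.

Definition free_gen (i : I) : free_group := \pi_free_group [:: (i, false)].

End FreeGroup.

Section Quotient.
Variables (G : groupType) (S : G -> Prop).

Inductive normal_closure : G -> Prop :=
| normal_closure_gen x : S x -> normal_closure x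
| normal_closure1 : normal_closure 1
| normal_closureM x y :
    normal_closure x -> normal_closure y -> normal_closure (x * y)
| normal_closureV x : normal_closure x -> normal_closure x^-1
| normal_closureJ x g : normal_closure x -> normal_closure (x ^ g).

Definition coset_eqb (x y : G) : bool := `[< normal_closure (x^-1 * y) >].

Lemma coset_eqb_refl : reflexive coset_eqb.
Proof. by move=> x; apply/asboolP; rewrite mulVg; exact: normal_closure1. Qed.

Lemma coset_eqb_sym : symmetric coset_eqb.
Proof.
by move=> x y; apply/asboolP/asboolP => /normal_closureV; rewrite invgM invgK.
Qed.

Lemma coset_eqb_trans : transitive coset_eqb.
Proof.
move=> y x z /asboolP xy /asboolP yz; apply/asboolP.
by have := normal_closureM xy yz; rewrite mulgA mulgK.
Qed.

Canonical coset_equiv :=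
  EquivRel coset_eqb coset_eqb_refl coset_eqb_sym coset_eqb_trans.

(* G / <<S>>, the quotient of G by the normal closure of S.                   *)
Definition quotient_group := {eq_quot coset_eqb}.

HB.instance Definition _ := Choice.on quotient_group.
HB.instance Definition _ := EqQuotient.on quotient_group.

Definition quotient_one : quotient_group := \pi_quotient_group 1.
Definition quotient_mul (x y : quotient_group) : quotient_group :=
  \pi_quotient_group (repr x * repr y).
Definition quotient_inv (x : quotient_group) : quotient_group :=
  \pi_quotient_group (repr x)^-1.

Lemma quotient_piP x y :
  \pi_quotient_group x = \pi_quotient_group y <-> normal_closure (x^-1 * y).
Proof. by split=> [/eqmodP/asboolP | xy] //; apply/eqmodP/asboolP. Qed.

Lemma quotient_repr x : normal_closure ((repr (\pi_quotient_group x))^-1 * x).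
Proof. by apply/quotient_piP; rewrite reprK. Qed.

Lemma quotient_mul_pi x y :
  quotient_mul (\pi_quotient_group x) (\pi_quotient_group y) =
  \pi_quotient_group (x * y).
Proof.
apply/quotient_piP; set x' := repr _; set y' := repr _.
have -> : (x' * y')^-1 * (x * y) = ((x'^-1 * x) ^ y') * (y'^-1 * y).
  by rewrite invgM conjgE !mulgA mulgK.
by apply: normal_closureM; [apply: normal_closureJ|]; exact: quotient_repr.
Qed.

Lemma quotient_inv_pi x :
  quotient_inv (\pi_quotient_group x) = \pi_quotient_group x^-1.
Proof.
apply/quotient_piP; set x' := repr _; rewrite invgK.
have -> : x' * x^-1 = ((x'^-1 * x)^-1) ^ x'^-1.
  by rewrite conjgE invgM !invgK !mulgA mulgK.
by apply/normal_closureJ/normal_closureV; exact: quotient_repr.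
Qed.

Fact quotient_mulA : associative quotient_mul.
Proof.
move=> x y z.
elim/quotW: x => x; elim/quotW: y => y; elim/quotW: z => z.
by rewrite (quotient_mul_pi x y) (quotient_mul_pi y z) !quotient_mul_pi mulgA.
Qed.

Fact quotient_mul1 : left_id quotient_one quotient_mul.
Proof. by move=> x; elim/quotW: x => x; rewrite quotient_mul_pi mul1g. Qed.

Fact quotient_mulr1 : right_id quotient_one quotient_mul.
Proof. by move=> x; elim/quotW: x => x; rewrite quotient_mul_pi mulg1. Qed.

Fact quotient_mulV : left_inverse quotient_one quotient_inv quotient_mul.
Proof. by move=> x; elim/quotW: x => x; rewrite quotient_inv_pi quotient_mul_pi mulVg. Qed.

Fact quotient_mulrV : right_inverse quotient_one quotient_inv quotient_mul.
Proof. by move=> x; elim/quotW: x => x; rewrite quotient_inv_pi quotient_mul_pi mulgV. Qed.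

HB.instance Definition _ := isGroup.Build quotient_group
  quotient_mulA quotient_mul1 quotient_mulr1 quotient_mulV quotient_mulrV.

End Quotient.

(* < I | lhs j = rhs j (j : J) >                                              *)
Definition presented (I : choiceType) (J : Type)
    (lhs rhs : J -> free_group I) : groupType :=
  quotient_group (fun w => exists j, w = lhs j * (rhs j)^-1).

Definition abelianisation (G : groupType) : groupType :=
  quotient_group (fun w : G => exists x y, w = [~ x, y]).

Definition free_of_rank (G : groupType) (k : nat) : Prop :=
  isomorphic G (free_group 'I_k).

(* [{freeg K}] is the direct sum of copies of Z indexed by K;                 *)
(* [to_multiplicative] is its group law in multiplicative notation.           *)
Definition is_free_abelian (A : groupType) : Prop :=
  exists K : choiceType, isomorphic A (Algebra.to_multiplicative {freeg K}).

Definition ord_add (n : nat) (i : 'I_n) (k : nat) : 'I_n :=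
  Ordinal (ltn_pmod (i + k) (leq_ltn_trans (leq0n i) (ltn_ord i))).

Definition gen_fibonacci (r n s : nat) : groupType :=
  @presented 'I_n 'I_n
    (fun i => \prod_(0 <= j < r) free_gen (ord_add i j))
    (fun i => \prod_(0 <= j < s) free_gen (ord_add i (j + r))).

(* < a, b | a^r = b^n > with a := false and b := true.                        *)
Definition torus_knot_group (r n : nat) : groupType :=
  @presented bool unit
    (fun _ => free_gen false ^+ r) (fun _ => free_gen true ^+ n).

(* Main.v *)
(* Homomorphisms from H(r,n,s) to a group are the same as n-periodic sequences x
   in it satisfying the relations (below: a fib_seq).

   If H^ab is free abelian, the coordinates of its generators are integer
   fib_seqs.  Such a sequence satisfies 2x_{i+r} = x_i + x_{i+r+s}, and summing
   squares over a period gives x_i = x_{i+r} = x_{i+s}.  Hence every fib_seq in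
   every abelian group has period d = gcd(r,n,s), and for s <> r its sums over d
   consecutive terms vanish.  Suitable test sequences turn this into arithmetic.

   For s <> r, it follows that H(r/d,n/d,s/d)^ab has no nonzero homomorphism to
   any 'F_p, so its circulant relation matrix M is invertible over Z.  Then
   V = M M^-T is orthogonal with integer entries and row sums 1, so it is a
   permutation matrix.  With P the cyclic shift and E = (P - 1) M
   = 2P^r - 1 - P^(r+s), one has E = - V E^T P; comparing entries forces P^r = 1,
   P^s = 1 or P^(r+s) = 1, and in the last case E = 2(P^r - 1) would make P - 1
   even.

   For s = r, the test sequence is the difference sequence, in Z/(n/d), of the
   function sending i to i/d if d divides i and to 0 otherwise.

   If s = r and gcd(r,n) = 1, the product w of r consecutive generators does not
   depend on the starting point, and conjugation by w shifts indices by r.  With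
   kr = ln + 1, the isomorphism to <a, b | a^r = b^n> sends w to b and x_0 w^-k
   to a^-l. *)
From HB Require Import structures.
Require Import Defs.
From mathcomp Require Import all_boot all_order all_algebra.
From mathcomp Require Import generic_quotient.
From mathcomp.multinomials Require Import freeg.
From mathcomp Require Import zify ring.

Set Implicit Arguments.
Unset Strict Implicit.
Unset Printing Implicit Defensive.

(** * Universal properties *)

Section Morphisms.
Import GRing.Theory.
Local Open Scope group_scope.
Local Open Scope quotient_scope.

Lemma morph1 (G H : groupType) (f : {multiplicative G -> H}) : f 1 = 1.
Proof. by apply: (mulgI (f 1)); rewrite -gmulfM !mulg1. Qed.

Lemma morphV (G H : groupType) (f : {multiplicative G -> H}) x :
  f x^-1 = (f x)^-1.
Proof. by apply: (mulgI (f x)); rewrite -gmulfM !mulgV morph1. Qed.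

Lemma morph_prod (G H : groupType) (f : {multiplicative G -> H})
    (I : Type) (r : seq I) (F : I -> G) :
  f (\prod_(i <- r) F i) = \prod_(i <- r) f (F i).
Proof. by apply: big_morph; [exact: gmulfM | exact: morph1]. Qed.

Lemma morphX (G H : groupType) (f : {multiplicative G -> H}) x m :
  f (x ^+ m) = f x ^+ m.
Proof. by elim: m => [|m IHm]; rewrite ?morph1 // !expgS gmulfM IHm. Qed.

Lemma isomorphic_cancel (G H : groupType)
    (f : {multiplicative G -> H}) (g : {multiplicative H -> G}) :
  cancel f g -> cancel g f -> isomorphic G H.
Proof. by move=> fK gK; exists f; exists g. Qed.

Lemma free_pi_surj (I : choiceType) (x : free_group I) :
  exists u, x = \pi u.
Proof. by exists (repr x); rewrite reprK. Qed.

Section FreeUniversal.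
Variables (I : choiceType) (G : groupType) (g : I -> G).

Definition letter_eval (a : I * bool) : G := if a.2 then (g a.1)^-1 else g a.1.

Definition word_eval (u : word I) : G := \prod_(a <- u) letter_eval a.

Lemma word_eval_eq u v : word_eq u v -> word_eval u = word_eval v.
Proof.
rewrite /word_eval.
elim=> // [{}u {}v w _ -> _ -> // | u1 u2 v1 v2 _ e1 _ e2 | i b].
  by rewrite !big_cat /= e1 e2.
by rewrite !big_cons !big_nil /letter_eval; case: b; rewrite /= mulg1 ?mulVg ?mulgV.
Qed.

Definition free_lift (x : free_group I) : G := word_eval (repr x).

Lemma free_lift_pi u : free_lift (\pi u) = word_eval u.
Proof. exact/word_eval_eq/free_repr. Qed.

Fact free_lift_morph : {morph free_lift : x y / x * y}.
Proof.
move=> x y; have [u ->] := free_pi_surj x; have [v ->] := free_pi_surj y.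
by rewrite [_ * _]free_mul_pi !free_lift_pi /word_eval big_cat.
Qed.

HB.instance Definition _ := isMultiplicative.Build _ _ _ free_lift_morph.

Lemma free_lift_gen i : free_lift (free_gen i) = g i.
Proof. by rewrite free_lift_pi /word_eval big_seq1. Qed.

End FreeUniversal.

Lemma free_ext (I : choiceType) (G : groupType)
    (f h : {multiplicative free_group I -> G}) :
  (forall i, f (free_gen i) = h (free_gen i)) -> f =1 h.
Proof.
move=> eq_fh x; have [u ->] := free_pi_surj x.
elim: u => [|[i b] u IHu].
  by have -> : \pi_(free_group I) [::] = 1 by []; rewrite !morph1.
have -> : \pi_(free_group I) ((i, b) :: u) =
    (if b then (free_gen i)^-1 else free_gen i) * \pi u.
  case: b; first have -> : (free_gen i)^-1 = \pi [:: (i, true)].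
  - exact: free_inv_pi.
  - exact/esym/free_mul_pi.
  - exact/esym/free_mul_pi.
by rewrite !gmulfM IHu; case: b; rewrite ?morphV eq_fh.
Qed.

Section QuotientUniversal.
Variables (G : groupType) (S : G -> Prop).

Definition to_quotient (x : G) : quotient_group S := \pi x.

Fact to_quotient_morph : {morph to_quotient : x y / x * y}.
Proof. by move=> x y; rewrite [RHS]quotient_mul_pi. Qed.

HB.instance Definition _ := isMultiplicative.Build _ _ _ to_quotient_morph.

Lemma to_quotient_surj y : exists x, y = to_quotient x.
Proof. by exists (repr y); rewrite /to_quotient reprK. Qed.

(** By induction on its generation, the whole normal closure is killed by [f], so [f] does not see
    the choice of [repr] and can be evaluated on it. *)
Lemma quotient_lift (H : groupType) (f : {multiplicative G -> H}) :
    (forall x, S x -> f x = 1) ->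
  exists h : {multiplicative quotient_group S -> H},
    forall x, h (to_quotient x) = f x.
Proof.
move=> fS1.
have f1 x : normal_closure S x -> f x = 1.
  elim=> {x} [x /fS1|| x y _ fx _ fy | x _ fx | x g _ fx] //.
  - exact: morph1.
  - by rewrite gmulfM fx fy mulg1.
  - by rewrite morphV fx invg1.
  - by rewrite conjgE !gmulfM fx mul1g -gmulfM mulVg morph1.
have f_repr x : f (repr (\pi_(quotient_group S) x)) = f x.
  apply: (mulgI (f (repr (\pi_(quotient_group S) x)))^-1).
  by rewrite mulVg -morphV -gmulfM f1 //; exact: quotient_repr.
have fM : {morph (fun x : quotient_group S => f (repr x)) : x y / x * y}.
  move=> y z; have [{}y ->] := to_quotient_surj y; have [{}z ->] := to_quotient_surj z.
  by rewrite [_ * _]quotient_mul_pi !f_repr gmulfM.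
pose h := isMultiplicative.Build _ _ (fun x : quotient_group S => f (repr x)) fM.
pose hh : {multiplicative _ -> _} := HB.pack (fun x : quotient_group S => f (repr x)) h.
by exists hh => x; exact: f_repr.
Qed.

Lemma to_quotient_eq1 x : S x -> to_quotient x = 1.
Proof.
move=> Sx; apply/quotient_piP.
by rewrite mulg1; exact/normal_closureV/normal_closure_gen.
Qed.

Lemma quotient_ext (H : groupType)
    (f h : {multiplicative quotient_group S -> H}) :
  (forall x, f (to_quotient x) = h (to_quotient x)) -> f =1 h.
Proof. by move=> eq_fh y; have [x ->] := to_quotient_surj y. Qed.

End QuotientUniversal.

Section PresentedUniversal.
Variables (I : choiceType) (J : Type) (lhs rhs : J -> free_group I).

Definition presented_gen (i : I) : presented lhs rhs :=
  to_quotient _ (free_gen i).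

Lemma presented_lift (G : groupType) (g : I -> G) :
    (forall j, free_lift g (lhs j) = free_lift g (rhs j)) ->
  exists h : {multiplicative presented lhs rhs -> G},
    forall i, h (presented_gen i) = g i.
Proof.
move=> g_rel.
have [x [j ->]|h hE] := @quotient_lift (free_group I)
    (fun w => exists j, w = lhs j * (rhs j)^-1) G (free_lift g).
  by rewrite gmulfM morphV /= g_rel mulgV.
by exists h => i; rewrite hE /= free_lift_gen.
Qed.

Lemma presented_ext (G : groupType)
    (f h : {multiplicative presented lhs rhs -> G}) :
  (forall i, f (presented_gen i) = h (presented_gen i)) -> f =1 h.
Proof.
move=> eq_fh; apply: quotient_ext => x.
pose q := to_quotient (fun w => exists j, w = lhs j * (rhs j)^-1).
exact: (@free_ext _ _ (f \o q) (h \o q)).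
Qed.

Lemma presented_rel j :
  to_quotient _ (lhs j) = to_quotient _ (rhs j) :> presented lhs rhs.
Proof.
apply: divg1_eq; rewrite -morphV -gmulfM.
by apply: to_quotient_eq1; exists j.
Qed.

End PresentedUniversal.

Section Abelianisation.
Variable G : groupType.

Definition to_ab : {multiplicative G -> abelianisation G} := @to_quotient G _.

Lemma ab_comm (x y : abelianisation G) : x * y = y * x.
Proof.
have [{}x ->] := to_quotient_surj x; have [{}y ->] := to_quotient_surj y.
rewrite -!gmulfM commgC gmulfM.
rewrite [X in _ * X](_ : _ = 1) ?mulg1 //.
by apply: to_quotient_eq1; exists x, y.
Qed.

Lemma ab_lift (V : zmodType)
    (f : {multiplicative G -> Algebra.to_multiplicative V}) :
  exists h : {multiplicative abelianisation G -> Algebra.to_multiplicative V},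
    forall x, h (to_ab x) = f x.
Proof.
apply: quotient_lift => _ [x [y ->]].
by rewrite !gmulfM !morphV [f x * _]Algebra.commuteT mulKg mulVg.
Qed.

(* [fglift] needs a zmodule as its target. *)
Definition additive_ab : Type := abelianisation G.
HB.instance Definition _ := Choice.on additive_ab.
HB.instance Definition _ := GRing.isZmodule.Build additive_ab
  (@mulgA (abelianisation G)) ab_comm (@mul1g (abelianisation G)) (@mulVg (abelianisation G)).

(** The map [h'] induced by [h] is inverted by [bb], the additive extension of [k |-> to_ab (g k)].
    The hypothesis [ext] expresses that the [g k] generate the abelianisation, which gives one
    composite. *)
Lemma ab_is_free (K : choiceType) (g : K -> G)
    (h : {multiplicative G -> Algebra.to_multiplicative {freeg K}}) :
    (forall k, h (g k) = << k >>%R) ->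
    (forall f f' : {multiplicative G -> abelianisation G},
       (forall k, f (g k) = f' (g k)) -> f =1 f') ->
  is_free_abelian (abelianisation G).
Proof.
move=> hg ext; exists K; have [h' h'E] := ab_lift h.
pose b : {freeg K} -> abelianisation G :=
  fglift (fun k => to_ab (g k) : zmodule additive_ab).
have bB : {morph b : x y / (x - y)%R >-> x * y^-1}.
  by move=> x y; exact: (lift_is_additive (fun k => to_ab (g k) : zmodule additive_ab) x y).
have b0 : b 0%R = 1 by rewrite -[0%R in LHS](subrr 0%R) bB mulgV.
have bM : {morph (b : Algebra.to_multiplicative {freeg K} -> _) : x y / x * y}.
  move=> x y; have -> : x * y = (x - (0 - y))%R by rewrite sub0r opprK.
  by rewrite !bB b0 mul1g invgK.
pose bb : {multiplicative Algebra.to_multiplicative {freeg K} -> abelianisation G}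
  := HB.pack b (isMultiplicative.Build _ _ _ bM).
have bg k : bb << k >>%R = to_ab (g k).
  by rewrite /= /b liftU scale1r.
have bhK x : bb (h x) = to_ab x.
  apply: (ext (bb \o h) to_ab) => k.
  exact: etrans (congr1 bb (hg k)) (bg k).
have bhK' : cancel h' bb.
  have ext' := @quotient_ext G _ _ (bb \o h') idfun.
  by apply: ext' => x; exact: etrans (congr1 bb (h'E x)) (bhK x).
apply: (isomorphic_cancel bhK') => D.
(* Since [h'] already has a left inverse, the other composite only needs surjectivity, obtained
   summand by summand and then by induction on the integer coefficient. *)
suff [y <-] : exists y, h' y = D by rewrite bhK'.
rewrite -[D]freeg_sumE; elim/big_ind: _ => [|_ _ [y <-] [z <-]|k _].
- by exists 1; exact: morph1.
- by exists (y * z); exact: gmulfM.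
rewrite -[coeff k D]intz -freegU_mulz; elim/int_rect: (coeff k D) => [|m [y Hy]|m [y Hy]].
- by exists 1; rewrite morph1.
- exists (to_ab (g k) * y); rewrite gmulfM h'E hg Hy.
  by rewrite -[m.+1]addn1 PoszD mulrzDr addrC.
- exists ((to_ab (g k))^-1 * y); rewrite gmulfM morphV h'E hg Hy.
  by rewrite -[m.+1]addn1 PoszD opprD mulrzDr mulrN1z addrC.
Qed.

End Abelianisation.

Lemma free_of_rank_ab (G : groupType) k :
  free_of_rank G k -> is_free_abelian (abelianisation G).
Proof.
move=> [f [f' fK f'K]].
have f'M : {morph f' : x y / x * y} := can2_gmulfM fK f'K.
pose f'm := isMultiplicative.Build _ _ _ f'M.
pose g : {multiplicative free_group 'I_k -> G} := HB.pack f' f'm.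
pose c : 'I_k -> Algebra.to_multiplicative {freeg 'I_k} :=
  fun i => << i >>%R.
apply: (@ab_is_free G 'I_k (f' \o @free_gen _) (free_lift c \o f)) => [i|h h' hh'] /=.
  by rewrite f'K free_lift_gen.
by move=> x; rewrite -(fK x); apply: (@free_ext _ _ (h \o g) (h' \o g)).
Qed.

End Morphisms.

(** * Sequences satisfying the relations *)

Section Windows.
Local Open Scope group_scope.

Definition window (G : groupType) (x : nat -> G) i k : G :=
  \prod_(0 <= j < k) x (i + j)%N.

Definition fib_seq r n s (G : groupType) (x : nat -> G) : Prop :=
  (forall i, x (i + n)%N = x i) /\
  (forall i, window x i r = window x (i + r) s).

Lemma window0 (G : groupType) (x : nat -> G) i : window x i 0 = 1.
Proof. exact: big_geq. Qed.

Lemma window1 (G : groupType) (x : nat -> G) i : window x i 1 = x i.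
Proof. by rewrite /window big_nat1 addn0. Qed.

Lemma windowD (G : groupType) (x : nat -> G) i k l :
  window x i (k + l) = window x i k * window x (i + k) l.
Proof.
rewrite /window (big_cat_nat (n := k)) ?leq_addr //=; congr (_ * _).
rewrite -{1}[k]add0n big_addn addKn.
by apply: eq_bigr => j _; rewrite -addnA [(j + k)%N]addnC.
Qed.

Lemma windowS (G : groupType) (x : nat -> G) i k :
  window x i k.+1 = x i * window x i.+1 k.
Proof. by rewrite -add1n windowD window1 addn1. Qed.

Lemma windowSr (G : groupType) (x : nat -> G) i k :
  window x i k.+1 = window x i k * x (i + k)%N.
Proof. by rewrite -addn1 windowD window1. Qed.

Lemma eq_window (G : groupType) (x y : nat -> G) i k :
  x =1 y -> window x i k = window y i k.
Proof. by move=> eq_xy; apply: eq_bigr. Qed.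

Lemma morph_window (G H : groupType) (f : {multiplicative G -> H})
    (x : nat -> G) i k :
  f (window x i k) = window (f \o x) i k.
Proof. exact: morph_prod. Qed.

Lemma morph_fib_seq r n s (G H : groupType) (f : {multiplicative G -> H})
    (x : nat -> G) :
  fib_seq r n s x -> fib_seq r n s (f \o x).
Proof.
case=> per rel; split=> i; first by rewrite /= per.
by rewrite -!morph_window rel.
Qed.

Section Periodic.
Variables (G : Type) (x : nat -> G).

Lemma periodM n : (forall i, x (i + n)%N = x i) ->
  forall q i, x (i + q * n)%N = x i.
Proof.
move=> per; elim=> [|q IHq] i; first by rewrite addn0.
by rewrite mulSn addnCA addnC per IHq.
Qed.

Lemma period_dvd n m : (forall i, x (i + n)%N = x i) -> n %| m ->
  forall i, x (i + m)%N = x i.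
Proof. by move=> per /dvdnP[q ->]; exact: periodM. Qed.

Lemma period_modn n : (forall i, x (i + n)%N = x i) ->
  forall i, x (i %% n)%N = x i.
Proof. by move=> per i; rewrite {2}(divn_eq i n) addnC periodM. Qed.

Lemma period_gcd a b : (forall i, x (i + a)%N = x i) ->
  (forall i, x (i + b)%N = x i) -> forall i, x (i + gcdn a b)%N = x i.
Proof.
move=> pera perb i; case: (posnP a) => [->|a_gt0]; first by rewrite gcd0n perb.
case: (egcdnP b a_gt0) => km kn e _.
by rewrite -(periodM perb kn) -addnA [(gcdn a b + _)%N]addnC -e periodM.
Qed.

End Periodic.

Lemma window_period (G : groupType) (x : nat -> G) n m k :
  (forall i, x (i + n)%N = x i) -> n %| m ->
  forall i, window x (i + m) k = window x i k.
Proof.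
move=> per nm i; apply: eq_bigr => j _.
by rewrite addnAC (period_dvd per nm).
Qed.

(* The two sides of a relation overlap, up to a shift by a multiple of [n], in a
   common window of length [minn r s]; cancelling it leaves a window of length
   [d], and every [d]-window arises in this way. *)
Lemma fib_seq_windows (r n s d : nat) (G : groupType) (x : nat -> G) :
    `|r - s|%N = d -> n %| r \/ n %| s -> 0 < n ->
    (forall i, x (i + n)%N = x i) ->
  (forall i, window x i r = window x (i + r) s) <->
  (forall i, window x i d = 1).
Proof.
move=> rs nrs n_gt0 per.
(* An offset by [a] is harmless: moving a further [a * (n - 1)] completes it to a multiple of the
   period [n]. *)
have shift a : (forall i, window x i d = 1) <->
    (forall i, window x (i + a) d = 1).
  split=> [h i | h i]; first exact: h.
  have -> : window x i d = window x (i + a * n) d.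
    by rewrite (window_period _ per) ?dvdn_mull.
  by rewrite -[n]prednK // mulnS [(a + _)%N]addnC addnA h.
have [lesr|ltrs] := leqP s r.
- have {rs} er : r = (s + d)%N by lia.
  subst r.
  case: nrs => nrs.
  + split=> [h | h i].
      apply/(shift s) => i.
      have := h i; rewrite windowD (window_period _ per nrs) => e.
      by apply: (mulgI (window x i s)); rewrite mulg1.
    by rewrite windowD (window_period _ per nrs) h mulg1.
  + have e i : window x (i + (s + d)) s = window x (i + d) s.
      by rewrite addnA addnAC (window_period _ per nrs).
    split=> [h i | h i].
      have := h i; rewrite e addnC windowD => {}h.
      by apply: (mulIg (window x (i + d) s)); rewrite mul1g.
    by rewrite e addnC windowD h mul1g.
- have {rs}es : s = (r + d)%N by lia.
  case: nrs => nrs.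
  + have e i : window x (i + r) s = window x i r * window x (i + (r + r)) d.
      by rewrite es windowD (window_period _ per nrs) addnA.
    split=> [h | h i]; last by rewrite e h mulg1.
    apply/(shift (r + r)%N) => i.
    by apply: (mulgI (window x i r)); rewrite mulg1 -e -h.
  + have e i : window x (i + r) s = window x (i + r) d * window x i r.
      by rewrite {1}es [(r + d)%N]addnC windowD -addnA -es (window_period _ per nrs).
    split=> [h | h i]; last by rewrite e h mul1g.
    apply/(shift r) => i.
    by apply: (mulIg (window x i r)); rewrite mul1g -e -h.
Qed.

(** Both [x i] and [x (i + d)] are inverse to the product of the [d - 1] terms between them. *)
Lemma window1_period d (G : groupType) (x : nat -> G) : 0 < d ->
  (forall i, window x i d = 1) -> forall i, x (i + d)%N = x i.
Proof.
case: d => // d _ h i; apply: (mulgI (window x i.+1 d)).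
rewrite addnS -addSn -windowSr h; apply/esym.
by apply: (mulgI (x i)); rewrite mulg1 mulgA -windowS h mul1g.
Qed.

Lemma period_window1 d (G : groupType) (x : nat -> G) :
  (forall i, x (i + d)%N = x i) -> window x 0 d = 1 ->
  forall i, window x i d = 1.
Proof.
case: d => [|d] per h; elim=> [|i IHi] //; first by rewrite window0.
rewrite windowSr addSn -addnS per; apply: (mulgI (x i)).
by rewrite mulgA -windowS IHi mul1g mulg1.
Qed.

End Windows.

(** * The universal property of H(r,n,s) in terms of sequences *)

Section GenFibonacci.
Local Open Scope group_scope.
Variables (r n s : nat).
Hypothesis n_gt0 : 0 < n.

Let lhs (i : 'I_n) := \prod_(0 <= j < r) free_gen (ord_add i j).
Let rhs (i : 'I_n) := \prod_(0 <= j < s) free_gen (ord_add i (j + r)).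

Definition fib_gen (i : nat) : gen_fibonacci r n s :=
  presented_gen _ _ (Ordinal (ltn_pmod i n_gt0)).

Lemma fib_gen_ord (i : 'I_n) : fib_gen i = presented_gen _ _ i.
Proof. by congr presented_gen; apply/val_inj; rewrite /= modn_small. Qed.

Lemma fib_genP : fib_seq r n s fib_gen.
Proof.
split=> i.
  by congr presented_gen; apply/val_inj; rewrite /= modnDr.
pose j := Ordinal (ltn_pmod i n_gt0).
have := presented_rel lhs rhs j.
rewrite !morph_prod /window.
rewrite [LHS](eq_bigr (fun k => fib_gen (i + k))); last first.
  move=> k _; congr (to_quotient _ (free_gen _)); apply/val_inj.
  by rewrite /= modnDml.
move=> ->; apply: eq_bigr => k _; congr (to_quotient _ (free_gen _)); apply/val_inj.
by rewrite /= modnDml -addnA [(r + k)%N]addnC.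
Qed.

Lemma fib_lift (G : groupType) (x : nat -> G) : fib_seq r n s x ->
  exists h : {multiplicative gen_fibonacci r n s -> G},
    forall i, h (fib_gen i) = x i.
Proof.
move=> [per rel].
have [i|h hE] := @presented_lift _ _ lhs rhs G (fun i => x i); last first.
  by exists h => i; rewrite hE; exact: (period_modn per).
rewrite !morph_prod.
rewrite (eq_bigr (fun k => x (i + k)%N)); last first.
  by move=> k _; rewrite /= free_lift_gen (period_modn per).
have := rel i; rewrite /window => ->.
apply: eq_bigr => k _; rewrite /= free_lift_gen.
by rewrite (period_modn per) -addnA [(r + k)%N]addnC.
Qed.

Lemma fib_ext (G : groupType)
    (f h : {multiplicative gen_fibonacci r n s -> G}) :
  (forall i, f (fib_gen i) = h (fib_gen i)) -> f =1 h.
Proof.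
by move=> eq_fh; apply: presented_ext => i; rewrite -fib_gen_ord.
Qed.

End GenFibonacci.

(** * The free cases *)

Section Isomorphisms.
Local Open Scope group_scope.

Lemma window_ord (G : groupType) (x : nat -> G) k :
  window x 0 k = \prod_(i < k) x i.
Proof. by rewrite /window big_mkord. Qed.

(** The two sides of each relation are windows that differ by a shift by [r], a multiple of [n], so
    all relations are vacuous. *)
Lemma gen_fibonacci_free_diag r n : 0 < n -> n %| r ->
  free_of_rank (gen_fibonacci r n r) n.
Proof.
move=> n_gt0 nr.
pose x i : free_group 'I_n := free_gen (Ordinal (ltn_pmod i n_gt0)).
have per i : x (i + n)%N = x i.
  by congr free_gen; apply/val_inj; rewrite /= modnDr.
have [|f fE] := @fib_lift r n r n_gt0 _ x.
  by split=> // i; rewrite (window_period _ per nr).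
pose g := free_lift (fun i : 'I_n => fib_gen r r n_gt0 i).
apply: (@isomorphic_cancel _ _ f g).
  apply: (@fib_ext r n r n_gt0 _ (g \o f) idfun) => i.
  rewrite /= fE free_lift_gen /=.
  exact/period_modn/(fib_genP r r n_gt0).1.
apply: (@free_ext _ _ (f \o g) idfun) => i.
by rewrite /= free_lift_gen fE; congr free_gen; apply/val_inj; rewrite /= modn_small.
Qed.

(** The relations amount to triviality of all [d]-windows. This forces period [d] and leaves [d]
    generators with the single relation that their product is 1, so the last generator can be
    eliminated. *)
Lemma gen_fibonacci_free (r n s d : nat) : 0 < n -> 0 < d -> d %| n ->
  `|r - s|%N = d -> n %| r \/ n %| s ->
  free_of_rank (gen_fibonacci r n s) d.-1.
Proof.
case: d => // e n_gt0 _ dn rs nrs.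
(* With [d = e + 1], the residues below [e] go to the free generators and the residue [e], where
   [insub] fails, to the value [z] that makes the product over a period trivial. *)
pose z : free_group 'I_e := (\prod_(i < e) free_gen i)^-1.
pose x i : free_group 'I_e := oapp (@free_gen 'I_e) z (insub (i %% e.+1)).
have xE (i : 'I_e) : x i = free_gen i.
  by rewrite /x modn_small ?valK // ltnS ltnW.
have xe : x e = z by rewrite /x modn_small // insubF // ltnn.
have per i : x (i + e.+1)%N = x i by rewrite /x modnDr.
have win i : window x i e.+1 = 1.
  apply: period_window1 => //; rewrite windowSr add0n xe window_ord.
  by under eq_bigr do rewrite xE; rewrite mulgV.
have pern : forall i, x (i + n)%N = x i := period_dvd per dn.
have [|f fE] := @fib_lift r n s n_gt0 _ x.
  by split=> //; apply/(fib_seq_windows rs nrs n_gt0 pern).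
pose a := fib_gen r s n_gt0.
have [a_per a_rel] := fib_genP r s n_gt0.
have a_win := (fib_seq_windows rs nrs n_gt0 a_per).1 a_rel.
have a_perd : forall i, a (i + e.+1)%N = a i := window1_period (ltn0Sn e) a_win.
pose g := free_lift (fun i : 'I_e => a i).
have gx i : i < e.+1 -> g (x i) = a i.
  rewrite ltnS leq_eqVlt => /predU1P[->|ie].
    rewrite xe [LHS]morphV morph_prod.
    under eq_bigr do rewrite /= free_lift_gen.
    rewrite -window_ord; apply: mulg1_eq.
    by rewrite -[a e]/(a (0 + e)%N) -windowSr.
  by rewrite (xE (Ordinal ie) : x i = _); exact: free_lift_gen.
apply: (@isomorphic_cancel _ _ f g).
  apply: (@fib_ext r n s n_gt0 _ (g \o f) idfun) => i.
  have := gx (i %% e.+1) (ltn_pmod i (ltn0Sn e)).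
  by rewrite (period_modn per) (period_modn a_perd) -fE.
apply: (@free_ext _ _ (f \o g) idfun) => i.
by rewrite /= free_lift_gen fE xE.
Qed.

(** As a function of the starting point, the [r]-window has period [n], and by the relations also
    period [r]. *)
Lemma window_coprime (G : groupType) (x : nat -> G) r n :
    coprime r n -> 0 < n -> fib_seq r n r x ->
  (forall i, window x i r = window x 0 r).
Proof.
move=> rn n_gt0 [per rel].
have perw i : window x (i + n) r = window x i r by exact: window_period.
have per1 := period_gcd (x := fun i => window x i r) (fun i => esym (rel i)) perw.
move=> i; have := period_modn per1 i.
by rewrite (eqP rn) modn1 => ->.
Qed.

(** The windows at [i] and [i + 1] have the same product [w] and share all terms but [x i] at the
    front of one and [x (i + r)] at the end of the other. *)
Lemma fib_seq_shift (G : groupType) (x : nat -> G) r n :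
    coprime r n -> 0 < n -> 0 < r -> fib_seq r n r x ->
  forall i, x (i + r)%N = x i ^ window x 0 r.
Proof.
move=> rn n_gt0 r_gt0 xP i; have win := window_coprime rn n_gt0 xP.
case: r r_gt0 rn xP win => // r _ rn xP win.
apply: (mulgI (window x i.+1 r)).
rewrite addnS -addSn -windowSr win conjgE.
have e : window x i.+1 r = (x i)^-1 * window x 0 r.+1.
  by rewrite -(win i) windowS mulKg.
by rewrite e !mulgA mulgK mulVg mul1g.
Qed.

(** In an abelian group the conjugation by [w] is trivial, so the generators have the coprime
    periods [r] and [n] and all coincide: the rank is 1. *)
Lemma gen_fibonacci_ab_coprime r n : 0 < n -> 0 < r -> coprime r n ->
  is_free_abelian (abelianisation (gen_fibonacci r n r)).
Proof.
move=> n_gt0 r_gt0 rn.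
pose V := Algebra.to_multiplicative {freeg unit}.
pose x (i : nat) : V := << tt >>%R.
have [//|h hE] := @fib_lift r n r n_gt0 _ x.
apply: (@ab_is_free _ unit (fun=> fib_gen r r n_gt0 0) h) => [[]|f f' ff'].
  exact: hE.
apply: (fib_ext (n_gt0 := n_gt0)).
have const (f1 : {multiplicative gen_fibonacci r n r -> abelianisation (gen_fibonacci r n r)}) i :
    f1 (fib_gen r r n_gt0 i) = f1 (fib_gen r r n_gt0 0).
  have yP := morph_fib_seq f1 (fib_genP r r n_gt0).
  have yr j : (f1 \o fib_gen r r n_gt0) (j + r)%N = (f1 \o fib_gen r r n_gt0) j.
    by rewrite (fib_seq_shift rn n_gt0 r_gt0 yP) conjgE ab_comm mulgK.
  have y1 := period_gcd yr yP.1.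
  by have := period_modn y1 i; rewrite (eqP rn) modn1.
by move=> i; rewrite !const; exact: (ff' tt).
Qed.

End Isomorphisms.

(** * Torus knot groups *)

Section TorusKnot.
Local Open Scope group_scope.

Lemma conj_commute (G : groupType) (x y : G) : commute x y -> x ^ y = x.
Proof. by move=> xy; rewrite conjgE xy mulKg. Qed.

(** The factor at [j] is [w^(-kj) u w^(k(j+1))], so adjacent powers of [w] cancel. *)
Lemma window_conj (G : groupType) (u w : G) k i :
  window (fun j => (u * w ^+ k) ^ (w ^+ (k * j))) 0 i = u ^+ i * w ^+ (k * i).
Proof.
elim: i => [|i IHi]; first by rewrite window0 muln0 mulg1.
rewrite windowSr IHi add0n conjgE expgSr -!mulgA; congr (_ * _).
by rewrite mulVKg -expgnDr mulnS.
Qed.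

Variables (r n k l : nat).
Hypotheses (r_gt0 : 0 < r) (n_gt0 : 0 < n) (bezout : (k * r = l * n + 1)%N).

Let coprime_rn : coprime r n.
Proof.
apply/coprimeP => //; exists (k, l); rewrite /= bezout; lia.
Qed.

(** The [r]-window telescopes to [a^(-lr) b^(kr) = b^(-ln) b^(ln+1) = b], and conjugation by powers
    of [b] fixes it, whence the relations. Period [n] holds because [b^n = a^r] commutes with both
    [a] and [b]. *)
Lemma torus_fib_seq (G : groupType) (a b : G) : a ^+ r = b ^+ n ->
  let x i := ((a ^+ l)^-1 * b ^+ k) ^ (b ^+ (k * i)) in
  fib_seq r n r x /\ window x 0 r = b.
Proof.
move=> ab x.
have w0 : window x 0 r = b.
  rewrite window_conj expVgn -expgnA bezout expgnDr expg1 mulgA.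
  have -> : a ^+ (l * r) = b ^+ (l * n).
    by rewrite mulnC expgnA ab -expgnA mulnC.
  by rewrite mulVg mul1g.
have xD i j : x (i + j)%N = x j ^ (b ^+ (k * i)).
  by rewrite /x -conjgM -expgnDr [in RHS]addnC mulnDr.
have wi i : window x i r = b.
  have -> : window x i r = window x 0 r ^ (b ^+ (k * i)).
    by rewrite conjg_prod; apply: eq_bigr => j _; rewrite xD.
  by rewrite w0 conj_commute //; exact/commuteX.
split=> //; split=> i; last by rewrite !wi.
have bn_a : commute (b ^+ n) a by rewrite -ab; exact/commute_sym/commuteX.
have bn_b : commute (b ^+ n) b by exact/commute_sym/commuteX.
rewrite addnC xD; apply/conj_commute/commute_sym; rewrite mulnC expgnA.
apply/commute_sym/commuteX/commute_sym.
rewrite /x conjgE; apply: commuteM; first exact/commuteV/commuteX.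
apply: commuteM; last exact/commuteX.
by apply: commuteM; [apply/commuteV|]; exact/commuteX.
Qed.

Section FromFibonacci.
Variables (G : groupType) (x : nat -> G).
Hypothesis xP : fib_seq r n r x.

Let w := window x 0 r.
Let u := x 0 * (w ^+ k)^-1.
(** This choice is forced: if [a^r = w^n] and [a^(-l) = u], then [a = a^(kr - ln) = w^(nk) u^n]. *)
Let a := w ^+ (n * k) * u ^+ n.

Let shift i j : x (i + r * j)%N = x i ^ (w ^+ j).
Proof.
elim: j => [|j IHj]; first by rewrite muln0 addn0 conjg1.
by rewrite mulnS addnCA addnC (fib_seq_shift coprime_rn) // IHj -conjgM -expgSr.
Qed.

Lemma fib_seq_conj i : x i = (u * w ^+ k) ^ (w ^+ (k * i)).
Proof.
rewrite mulgVK -shift add0n.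
rewrite (_ : (r * (k * i) = i + l * i * n)%N) ?(periodM xP.1) //.
by rewrite mulnA [(r * k)%N]mulnC bezout; lia.
Qed.

Let commute_wn_u : commute (w ^+ n) u.
Proof.
apply: commuteM; last exact/commuteV/commuteX2/commute_refl.
have e : x 0 ^ (w ^+ n) = x 0.
  by rewrite -shift add0n -[(r * n)%N]add0n (periodM xP.1).
by rewrite /commute [RHS]conjgC e.
Qed.

(** Writing every term as a conjugate of [x 0] telescopes [w] to [u^r w^(kr)], and [kr = ln + 1]. *)
Lemma torus_unit : u ^+ r = (w ^+ (l * n))^-1.
Proof.
have e : w = u ^+ r * w ^+ (k * r).
  by rewrite {1}/w (eq_window _ _ fib_seq_conj) window_conj.
apply: (mulIg (w ^+ (l * n))); rewrite mulVg; apply: (mulIg w).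
by rewrite mul1g -mulgA -expgSr -addn1 -bezout -e.
Qed.

Lemma torus_pow m : a ^+ m = w ^+ (n * k * m) * u ^+ (n * m).
Proof.
rewrite /a expgMn -?expgnA //; apply/commuteX/commute_sym.
by rewrite expgnA; exact/commuteX/commute_sym.
Qed.

Lemma torus_rel : a ^+ r = w ^+ n.
Proof.
rewrite torus_pow [(n * r)%N]mulnC (expgnA u) torus_unit expVgn -expgnA.
rewrite -mulnA bezout (_ : (n * (l * n + 1) = n + l * n * n)%N); last by lia.
by rewrite expgnDr mulgK.
Qed.

Lemma torus_inv : (a ^+ l)^-1 = u.
Proof.
apply: mulg1_eq; rewrite torus_pow -mulgA -expgSr.
rewrite (_ : (n * l).+1 = r * k)%N; last by rewrite mulnC; lia.
rewrite (expgnA u) torus_unit expVgn -expgnA.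
by rewrite (_ : (n * k * l = l * n * k)%N) ?mulgV //; lia.
Qed.

End FromFibonacci.

Lemma gen_fibonacci_torus_bezout :
  isomorphic (gen_fibonacci r n r) (torus_knot_group r n).
Proof.
pose T := torus_knot_group r n.
pose al : unit -> free_group bool := fun=> free_gen false ^+ r.
pose be : unit -> free_group bool := fun=> free_gen true ^+ n.
pose A : T := presented_gen al be false.
pose B : T := presented_gen al be true.
have AB : A ^+ r = B ^+ n by have := presented_rel al be tt; rewrite !morphX.
have [yP y0] := torus_fib_seq AB.
set y := (fun i => _) in yP y0.
have [f fE] := fib_lift n_gt0 yP.
pose x := fib_gen r r n_gt0.
have xP : fib_seq r n r x := fib_genP r r n_gt0.
pose w := window x 0 r; pose u := x 0 * (w ^+ k)^-1.
pose c := w ^+ (n * k) * u ^+ n.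
have [|g gE] := @presented_lift _ _ al be _ (fun b : bool => if b then w else c).
  by case; rewrite !morphX /= !free_lift_gen (torus_rel xP).
have gA : g A = c := gE false.
have gB : g B = w := gE true.
have fw : f w = B.
  by rewrite morph_window -[RHS]y0; apply: eq_window => i; exact: fE.
apply: (@isomorphic_cancel _ _ f g).
  apply: (@fib_ext r n r n_gt0 _ (g \o f) idfun) => i.
  rewrite /= fE [RHS](fib_seq_conj xP) /y.
  have gJ p q : g (p ^ q) = g p ^ g q by rewrite !conjgE !gmulfM morphV.
  rewrite gJ gmulfM morphV !morphX gA gB.
  by rewrite (torus_inv xP).
apply: (@presented_ext _ _ al be _ (f \o g) idfun) => -[] /=.
  by rewrite -/B gB.
rewrite -/A gA gmulfM !morphX gmulfM morphV morphX fw fE.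
rewrite /y muln0 expg0 conjg1 mulgK expVgn -expgnA.
have e : B ^+ (n * k) = A * A ^+ (l * n).
  by rewrite expgnA -AB -expgnA mulnC bezout addn1 expgS.
by rewrite [B ^+ _]e mulgK.
Qed.

End TorusKnot.

Lemma gen_fibonacci_torus r n : 0 < r -> 0 < n -> coprime r n ->
  isomorphic (gen_fibonacci r n r) (torus_knot_group r n).
Proof.
move=> r_gt0 n_gt0 rn; have [k l e _] := egcdnP n r_gt0.
by apply: (@gen_fibonacci_torus_bezout r n k l) => //; rewrite e (eqP rn).
Qed.

(** * Consequences of free abelianisation *)

Section FreeAbelianSequences.
Import Order.TTheory GRing.Theory Num.Theory.
Local Open Scope ring_scope.

Local Notation "V ^*m" := (Algebra.to_multiplicative V) (at level 2, format "V ^*m").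

Lemma window_telescope (V : zmodType) (x : nat -> V^*m) i k :
  (x i : V) - x (i + k)%N = (window x i k : V) - window x i.+1 k.
Proof.
apply/eqP; rewrite subr_eq addrAC eq_sym subr_eq; apply/eqP.
by rewrite [RHS](esym (windowS x i k)) windowSr.
Qed.

Lemma window_full (V : zmodType) (x : nat -> V^*m) n k :
  (forall i, x (i + n)%N = x i) -> window x k n = window x 0 n.
Proof.
move=> per; elim: k => // k <-; apply/esym/eqP.
by rewrite -subr_eq0 -window_telescope per subrr.
Qed.

(** Subtracting the relation at [i + 1] from the one at [i] leaves only the end terms of the
    windows. *)
Lemma fib_seq_step (V : zmodType) r n s (x : nat -> V^*m) i :
  fib_seq r n s x ->
  (x (i + r)%N : V) *+ 2 = (x i : V) + x (i + r + s)%N.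
Proof.
move=> [_ rel]; have := window_telescope x i r; rewrite !rel -window_telescope => e.
by rewrite mulr2n -[x i in RHS](subrK (x (i + r)%N : V)) e addrAC subrK.
Qed.

(** With [a = x i], [b = x (i + r + s)] and [c = x (i + r)], the identity [2c = a + b] gives
    [(a - b)^2 = 2a^2 + 2b^2 - 4c^2]. Over a full period the three sums of squares agree, so the
    nonnegative left sides sum to 0. *)
Lemma int_fib_seq_period r n s (x : nat -> int^*m) i : (0 < n)%N ->
  fib_seq r n s x -> x (i + r)%N = x i /\ x (i + s)%N = x i.
Proof.
move=> n_gt0 xP.
have per := xP.1.
have sq k : \sum_(0 <= j < n) (x (k + j)%N : int) ^+ 2 = \sum_(0 <= j < n) (x j : int) ^+ 2.
  apply: (@window_full _ (fun j => (x j : int) ^+ 2 : int^*m)) => j.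
  by rewrite per.
have e0 : \sum_(0 <= j < n) ((x j : int) - x (r + s + j)%N) ^+ 2 = 0.
  have e (a b c : int) : c *+ 2 = a + b ->
      (a - b) ^+ 2 = a ^+ 2 *+ 2 + b ^+ 2 *+ 2 - c ^+ 2 *+ 4.
    move=> e; have -> : c ^+ 2 *+ 4 = (c *+ 2) ^+ 2 by ring.
    by rewrite e; ring.
  rewrite (eq_bigr (fun j => (x j : int) ^+ 2 *+ 2 + (x (r + s + j)%N : int) ^+ 2 *+ 2
      - (x (r + j)%N : int) ^+ 2 *+ 4)); last first.
    move=> j _; apply: e; have := fib_seq_step j xP.
    by rewrite [(r + j)%N]addnC -[(r + s + j)%N]addnC addnA.
  by rewrite sumrB big_split /= !sumrMnl !sq; ring.
have per_rs j : x (j + (r + s))%N = x j.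
  have jn : (j %% n < n)%N by rewrite ltn_mod.
  rewrite -[RHS](period_modn per) -[LHS](period_modn per) -modnDml (period_modn per) addnC.
  apply/esym/eqP; rewrite -subr_eq0 -sqrf_eq0 big_mkord in e0 *.
  apply/eqP.
  exact: (psumr_eq0P (fun _ _ => sqr_ge0 _) e0 (i := Ordinal jn)).
(* Now [2 x (j + r) = 2 x j], and the factor 2 can be cancelled in the integers. *)
have per_r j : x (j + r)%N = x j.
  have := fib_seq_step j xP; rewrite -addnA per_rs.
  lia.
split=> //.
by rewrite -[LHS](per_r) addnAC -addnA per_rs.
Qed.

Lemma window_mul (V : zmodType) (x : nat -> V^*m) d q i :
  (forall j, x (j + d)%N = x j) ->
  window x i (q * d) = ((window x i d : V) *+ q : V^*m).
Proof.
move=> per; elim: q => [|q IHq]; first by rewrite mul0n window0.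
by rewrite mulSn windowD (window_period _ per) // IHq mulrS.
Qed.

(** With [W] the sum over one period [d], each relation reads [(r/d) W = (s/d) W]. *)
Lemma int_fib_seq_gcd r n s (x : nat -> int^*m) : (0 < n)%N ->
    fib_seq r n s x -> let d := gcdn (gcdn r n) s in
  (forall i, x (i + d)%N = x i) /\
  (s <> r -> forall i, window x i d = 0 :> int).
Proof.
move=> n_gt0 xP d.
have per_r i := (int_fib_seq_period i n_gt0 xP).1.
have per_s i := (int_fib_seq_period i n_gt0 xP).2.
have per := period_gcd (period_gcd per_r xP.1) per_s.
split=> // neq_sr i.
have dr : (d %| r)%N by rewrite /d (dvdn_trans (dvdn_gcdl _ _)) ?dvdn_gcdl.
have ds : (d %| s)%N by exact: dvdn_gcdr.
have := xP.2 i; rewrite (window_period _ per_r) //.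
rewrite -{1}(divnK dr) -{1}(divnK ds) !window_mul // => e.
have neq_q : (s %/ d <> r %/ d)%N.
  by move=> eq_q; apply: neq_sr; rewrite -(divnK dr) -(divnK ds) eq_q.
move: e neq_q; set W : int := window x i d.
rewrite -[W *+ (r %/ d)]mulr_natr -[W *+ (s %/ d)]mulr_natr.
move=> e neq_q.
have /eqP : W * ((r %/ d)%:R - (s %/ d)%:R) = 0 by rewrite mulrBr e subrr.
rewrite mulf_eq0 => /orP[/eqP //|].
by rewrite subr_eq0 eqr_nat => /eqP /esym.
Qed.

(** Both conclusions hold in each coordinate of the universal sequence [a] in the abelianisation,
    and [g] carries them to [x]. *)
Lemma free_abelian_fib_seq r n s (V : zmodType) (x : nat -> V^*m) :
    (0 < n)%N -> is_free_abelian (abelianisation (gen_fibonacci r n s)) ->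
    fib_seq r n s x -> let d := gcdn (gcdn r n) s in
  (forall i, x (i + d)%N = x i) /\
  (s <> r -> forall i, window x i d = 0 :> V).
Proof.
move=> n_gt0 [K [f [f' fK f'K]]] xP d.
have [h hE] := fib_lift n_gt0 xP; have [g gE] := ab_lift h.
pose a := to_ab _ \o fib_gen r s n_gt0.
have aP : fib_seq r n s a := morph_fib_seq _ (fib_genP r s n_gt0).
have xa i : x i = g (a i) by rewrite gE hE.
have coeffM k : {morph (coeff k : {freeg K}^*m -> int^*m) : y z / (y * z)%g}.
  exact: coeffD.
pose c k : {multiplicative {freeg K}^*m -> int^*m} :=
  HB.pack (coeff k : {freeg K}^*m -> int^*m) (isMultiplicative.Build _ _ _ (coeffM k)).
have yP k := int_fib_seq_gcd n_gt0 (morph_fib_seq (c k) (morph_fib_seq f aP)).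
have a_per i : a (i + d)%N = a i.
  apply: (can_inj fK); apply/eqP/freeg_eqP => k.
  exact: (yP k).1.
split=> [i | neq_sr i]; first by rewrite !xa a_per.
have a_win : window a i d = 1%g.
  apply: (can_inj fK); rewrite morph1; apply/eqP/freeg_eqP => k.
  rewrite [RHS]coeff0 -[RHS]((yP k).2 neq_sr i) -/d.
  by rewrite -[RHS]morph_window -[in RHS]morph_window.
by rewrite (eq_window i d xa) -[LHS]morph_window a_win morph1.
Qed.

End FreeAbelianSequences.

(** * The circulant relation matrix *)

Section Circulant.
Import Order.TTheory GRing.Theory Num.Theory.
Local Open Scope ring_scope.

Section Shift.
Variables (R : comNzRingType) (m : nat).
Implicit Types a b : 'I_m.+1.

(** The power [P^a] of the cyclic shift. The size [n] is written [m.+1] so that ['I_m.+1] is the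
    additive group of integers modulo [n]. *)
Definition shift_mx a : 'M[R]_m.+1 := \matrix_(i, j) (j == i + a)%:R.

Lemma shift_mxD a b : shift_mx a * shift_mx b = shift_mx (a + b).
Proof.
apply/matrixP => i j; rewrite !mxE (bigD1 (i + a)) //= !mxE eqxx mul1r addrA.
rewrite big1 ?addr0 // => k /negbTE ki.
by rewrite !mxE ki mul0r.
Qed.

Lemma shift_mx0 : shift_mx 0 = 1.
Proof. by apply/matrixP => i j; rewrite !mxE addr0 eq_sym. Qed.

Lemma tr_shift_mx a : (shift_mx a)^T = shift_mx (- a).
Proof.
apply/matrixP => i j; rewrite !mxE; congr (_%:R).
by rewrite -subr_eq eq_sym.
Qed.

Definition fib_mx r s : 'M[R]_m.+1 :=
  \sum_(0 <= j < r) shift_mx (inZp j) - \sum_(0 <= j < s) shift_mx (inZp (r + j)).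

Lemma inZpD i j : inZp (i + j) = inZp i + inZp j :> 'I_m.+1.
Proof. by apply/val_inj; rewrite /= modnDm. Qed.

(** Both sums in [fib_mx] are geometric in [P], so multiplication by [P - 1] telescopes them. *)
Lemma shift_fib_mx r s :
  (shift_mx (inZp 1) - 1) * fib_mx r s =
  shift_mx (inZp r) *+ 2 - 1 - shift_mx (inZp (r + s)).
Proof.
have tele i k : (shift_mx (inZp 1) - 1) * (\sum_(0 <= j < k) shift_mx (inZp (i + j))) =
    shift_mx (inZp (i + k)) - shift_mx (inZp i).
  rewrite big_distrr /= -[in shift_mx (inZp i)](addn0 i).
  rewrite -(telescope_sumr (fun j => shift_mx (inZp (i + j)))) //.
  apply: eq_bigr => j _; rewrite mulrBl mul1r shift_mxD -inZpD.
  by rewrite add1n addnS.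
rewrite mulrBr tele (tele 0%N) add0n.
have -> : inZp 0 = 0 :> 'I_m.+1 by apply/val_inj; rewrite /= mod0n.
by rewrite shift_mx0 mulr2n opprB addrACA addrA.
Qed.

Lemma comm_shift_fib_mx a r s : GRing.comm (shift_mx a) (fib_mx r s).
Proof.
by apply: commrB; apply: commr_sum => j _; rewrite /GRing.comm !shift_mxD addrC.
Qed.

Lemma tr_fib_mx r s : (fib_mx r s)^T =
  \sum_(0 <= j < r) shift_mx (- inZp j) - \sum_(0 <= j < s) shift_mx (- inZp (r + j)).
Proof.
rewrite /fib_mx raddfB /=; congr (_ - _); rewrite raddf_sum;
  by apply: eq_bigr => j _; exact: tr_shift_mx.
Qed.

Lemma comm_tr_fib_mx r s : GRing.comm (fib_mx r s) (fib_mx r s)^T.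
Proof.
rewrite tr_fib_mx.
apply: commrB; apply: commr_sum => j _; exact/commr_sym/comm_shift_fib_mx.
Qed.

Lemma shift_mx_const a : shift_mx a *m const_mx 1 = const_mx 1 :> 'cV_m.+1.
Proof.
apply/matrixP => i j; rewrite !mxE (bigD1 (i + a)) //= !mxE eqxx mul1r.
by rewrite big1 ?addr0 // => k /negbTE ki; rewrite !mxE ki mul0r.
Qed.

Lemma fib_mx_const r s : fib_mx r s *m const_mx 1 = const_mx (r%:R - s%:R) :> 'cV_m.+1.
Proof.
rewrite mulmxBl !mulmx_suml.
under eq_bigr do rewrite shift_mx_const.
under [X in _ - X]eq_bigr do rewrite shift_mx_const.
by rewrite !sumr_const_nat !subn0; apply/matrixP => i j; rewrite !mxE !mulmxnE !mxE.
Qed.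

Lemma tr_fib_mx_const r s :
  (fib_mx r s)^T *m const_mx 1 = const_mx (r%:R - s%:R) :> 'cV_m.+1.
Proof.
rewrite tr_fib_mx mulmxBl !mulmx_suml.
under eq_bigr do rewrite shift_mx_const.
under [X in _ - X]eq_bigr do rewrite shift_mx_const.
by rewrite !sumr_const_nat !subn0; apply/matrixP => i j; rewrite !mxE !mulmxnE !mxE.
Qed.

End Shift.

Lemma map_shift_mx (R S : comNzRingType) (f : {rmorphism R -> S}) m (a : 'I_m.+1) :
  map_mx f (shift_mx R a) = shift_mx S a.
Proof. by apply/matrixP => i j; rewrite !mxE rmorph_nat. Qed.

Lemma map_fib_mx (R S : comNzRingType) (f : {rmorphism R -> S}) m r s :
  map_mx f (fib_mx R m r s) = fib_mx S m r s.
Proof.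
rewrite /fib_mx raddfB /=; congr (_ - _); rewrite raddf_sum;
  by apply: eq_bigr => j _; exact: map_shift_mx.
Qed.

Lemma fib_mx_kernel (R : comNzRingType) m r s (v : 'cV[R]_m.+1) :
  fib_mx R m r s *m v = 0 ->
  fib_seq r m.+1 s ((fun i => v (inZp i) 0) : nat -> Algebra.to_multiplicative R).
Proof.
move=> Mv0; split=> i; first by congr (v _ _); apply/val_inj; rewrite /= modnDr.
have shiftE j : (shift_mx R (inZp j) *m v) (inZp i) 0 = v (inZp (i + j)) 0.
  rewrite mxE (bigD1 (inZp i + inZp j)) //= mxE eqxx mul1r -inZpD.
  by rewrite big1 ?addr0 // => k /negbTE ki; rewrite mxE -inZpD ki mul0r.
have /matrixP/(_ (inZp i) 0) := Mv0.
rewrite mulmxBl !mulmx_suml !mxE !summxE => /eqP; rewrite subr_eq0 => /eqP.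
rewrite (eq_bigr _ (fun j _ => shiftE j)) => e; apply: (etrans e).
by apply: eq_bigr => j _; rewrite shiftE addnA.
Qed.

(** Unless the determinant is 1 or -1, some prime [p] divides it (any prime if it is 0), and the
    matrix modulo [p] then has a nonzero kernel vector, which is a [fib_seq]. *)
Lemma fib_mx_unit m r s :
    (forall p, prime p -> forall c : nat -> Algebra.to_multiplicative 'F_p,
       fib_seq r m.+1 s c -> forall i, c i = 0 :> 'F_p) ->
  fib_mx int m r s \in unitmx.
Proof.
move=> ker0; rewrite unitmxE; set D := \det _.
have det_p p : prime p -> (D%:~R : 'F_p) != 0.
  move=> p_pr; rewrite -det_map_mx map_fib_mx -det_tr; apply/det0P => -[v v_neq0 vM].
  case/eqP: v_neq0; apply/trmx_inj/matrixP => i j; rewrite trmx0 mxE [j]ord1.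
  have /fib_mx_kernel/(ker0 p p_pr)/(_ i) : fib_mx 'F_p m r s *m v^T = 0.
    by apply/trmx_inj; rewrite trmx_mul trmxK vM trmx0.
  by rewrite valZpK !mxE => ->.
suff D1 : `|D|%N = 1%N.
  have [->|->] : D = 1 \/ D = -1 by lia.
    exact: unitr1.
  by rewrite unitrN unitr1.
apply/eqP/negP => /negP D_neq1.
have [p p_pr pD] : exists2 p, prime p & (p %| `|D|)%N.
  have [D0|D_gt1] : `|D|%N = 0%N \/ (1 < `|D|)%N by lia.
    by exists 2%N; rewrite ?D0.
  by exists (pdiv `|D|); [exact: pdiv_prime | exact: pdiv_dvd].
have /negP[] := det_p p p_pr.
have : (`|D|%N%:R : 'F_p) == 0.
  by rewrite -(dvdn_pcharf (pchar_Fp p_pr)).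
case: (D) => k; first by rewrite absz_nat.
by rewrite NegzE abszN absz_nat mulrNz oppr_eq0.
Qed.

(** The all-ones vector is an eigenvector with eigenvalue [r - s], which must then be invertible
    over the integers. *)
Lemma unitmx_augmentation m r s : fib_mx int m r s \in unitmx ->
  `|r - s|%N = 1%N.
Proof.
set M := fib_mx _ _ _ _ => uM.
have /matrixP/(_ 0 0) : invmx M *m const_mx (r%:R - s%:R) = const_mx 1 :> 'cV_m.+1.
  by rewrite -fib_mx_const mulKmx.
rewrite !mxE; under eq_bigr do rewrite mxE.
rewrite -mulr_suml => /eqP; set x := \sum_i _ => e.
have : absz (x * (r%:R - s%:R)) = 1%N by rewrite (eqP e).
by rewrite abszM => /eqP; rewrite muln_eq1 => /andP[_ /eqP]; lia.
Qed.

(** The entries of row 0 have sum 1 and sum of squares 1. As [z^2 - z] is nonnegative on integers,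
    each entry is 0 or 1. *)
Lemma orthogonal_row1 m (V : 'M[int]_m.+1) :
  V *m V^T = 1 -> V *m const_mx 1 = const_mx 1 :> 'cV_m.+1 ->
  exists k, forall j, V 0 j = (j == k)%:R.
Proof.
move=> /matrixP/(_ 0 0) VVT /matrixP/(_ 0 0) V1.
have sq1 : \sum_j V 0 j ^+ 2 = 1.
  have e1 : (1 : 'M[int]_m.+1) 0 0 = 1 by rewrite mxE eqxx.
  by rewrite -[RHS]e1 -VVT mxE; apply: eq_bigr => j _; rewrite mxE expr2.
have sum1 : \sum_j V 0 j = 1.
  by move: V1; rewrite !mxE => <-; apply: eq_bigr => j _; rewrite mxE mulr1.
have Vj j : V 0 j = 0 \/ V 0 j = 1.
  have pos (z : int) : 0 <= z ^+ 2 - z by nia.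
  have /psumr_eq0P/(_ j) : \sum_j (V 0 j ^+ 2 - V 0 j) = 0.
    by rewrite sumrB sq1 sum1.
  move=> /(_ (fun _ _ => pos _) isT); nia.
have [k Vk] : exists k, V 0 k = 1.
  have [k Vk|V0] := pickP (fun k => V 0 k != 0).
    by exists k; case: (Vj k) Vk => ->; rewrite ?eqxx.
  have : \sum_j V 0 j = 0.
    by apply: big1 => j _; apply/eqP; rewrite -[_ == _]negbK (V0 j).
  by rewrite sum1.
exists k => j; have [->|jk] := eqVneq j k; first by rewrite Vk.
move: sum1; rewrite (bigD1 k) //= Vk => /eqP.
rewrite -subr_eq0 addrAC subrr add0r => /eqP /psumr_eq0P -> //.
by move=> i _; case: (Vj i) => ->.
Qed.

Lemma fib_mx_unit_dvd m r s : fib_mx int m r s \in unitmx ->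
  (m.+1 %| r)%N \/ (m.+1 %| s)%N.
Proof.
set M := fib_mx _ _ _ _ => uM.
have rs1 := unitmx_augmentation uM.
have uMT : M^T \in unitmx by rewrite unitmx_tr.
pose V := M *m invmx M^T.
have MC : M *m M^T = M^T *m M := comm_tr_fib_mx int m r s.
have VMT : V *m M^T = M by rewrite mulmxKV.
(* Orthogonality rests on [M] and its transpose commuting, both being polynomials in shifts. *)
have VVT : V *m V^T = 1.
  rewrite /V trmx_mul trmx_inv trmxK.
  have -> : invmx M *m M^T = M^T *m invmx M.
    by apply: (can_inj (mulmxK uM)); rewrite mulmxKV // -mulmxA -MC mulKmx.
  by rewrite mulmxA mulmxKV // mulmxV.
(* Both [M] and its transpose multiply the all-ones vector by [q], which is nonzero since its
   absolute value is 1; cancelling [q] shows that [V] fixes this vector. *)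
have [|k Vk] := orthogonal_row1 VVT.
  pose q : int := r%:R - s%:R.
  have q0 : q != 0 by rewrite /q; lia.
  have e : q *: (invmx M^T *m const_mx 1) = const_mx 1 :> 'cV_m.+1.
    rewrite scalemxAr; have -> : q *: const_mx 1 = M^T *m const_mx 1 :> 'cV_m.+1.
      by rewrite tr_fib_mx_const; apply/matrixP => i j; rewrite !mxE mulr1.
    by rewrite mulKmx.
  have /matrixP e' : q *: (V *m const_mx 1) = q *: const_mx 1 :> 'cV_m.+1.
    rewrite /V -mulmxA scalemxAr e fib_mx_const.
    by apply/matrixP => i j; rewrite !mxE mulr1.
  apply/matrixP => i j; apply: (mulfI q0).
  by have := e' i j; rewrite mxE [in RHS]mxE.
pose S a := shift_mx int (a : 'I_m.+1).
set a : 'I_m.+1 := inZp r; set b : 'I_m.+1 := inZp s; set c : 'I_m.+1 := inZp 1.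
pose E := S a *+ 2 - 1 - S (a + b).
have EM : (S c - 1) * M = E by rewrite shift_fib_mx inZpD.
have EV : E = - (V *m (E^T *m S c)).
  have e1 X : V *m (M^T *m X *m S c) = M *m (X *m S c) by rewrite !mulmxA VMT.
  rewrite -EM trmx_mul e1 raddfB /= trmx1 tr_shift_mx.
  have -> : (shift_mx int (- c) - 1%:M) *m S c = 1 - S c.
    by rewrite -[LHS]/((_ - 1) * _) mulrBl mul1r shift_mxD addNr shift_mx0.
  rewrite -[M *m _]/(M * _) [M * (1 - _)]mulrBr mulr1 opprB mulrBl mul1r.
  by rewrite (comm_shift_fib_mx int c r s : S c * M = M * S c).
have ETS : E^T *m S c = S (c - a) *+ 2 - S c - S (c - (a + b)).
  rewrite /E !raddfB raddfMn /= trmx1 !tr_shift_mx !mulmxBl mul1mx.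
  have mE X : X *m S c = X * S c by [].
  by rewrite !mE mulrnAl !shift_mxD ![_ + c]addrC.
(* Row 0 of [EV], where [V] selects row [k], rearranged so that all coefficients are positive: an
   equality of two multisets of six indices each. *)
have key (j : 'I_m.+1) : ((j == a)%:R *+ 2 + (j == k + (c - a))%:R *+ 2 =
   (j == 0%R)%:R + (j == a + b)%:R + (j == k + c)%:R + (j == k + (c - (a + b)))%:R :> int).
  have SE x (i : 'I_m.+1) : S x i j = (j == i + x)%:R by rewrite mxE.
  have subE (A B C : 'M[int]_m.+1) i : (A *+ 2 - B - C) i j = A i j *+ 2 - B i j - C i j.
    by rewrite !mxE mulr2n.
  have VE (X : 'M[int]_m.+1) : (V *m X) 0 j = X k j.
    rewrite mxE (bigD1 k) //= Vk eqxx mul1r big1 ?addr0 // => i /negbTE ik.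
    by rewrite Vk ik mul0r.
  have /matrixP/(_ 0 j) := EV.
  rewrite [in RHS]mxE VE ETS subE /E -(shift_mx0 int m) subE !SE add0r addr0.
  by rewrite !add0r; lia.
have a0E : (a == 0) = (m.+1 %| r)%N by [].
have b0E : (b == 0) = (m.+1 %| s)%N by [].
rewrite -a0E -b0E.
have [//|a0] := eqVneq a 0; first by left.
have [//|b0] := eqVneq b 0; first by right.
(* The index 0 occurs on the right of [key]. As [a] is nonzero, only [k + (c - a)] can match it, and
   then 0 occurs twice on the left. Of the remaining indices on the right, now [a + b], [a] and
   [-b], only [a + b] can supply the second occurrence. *)
have /eqP kc : k + (c - a) == 0.
  rewrite eq_sym; apply: contraT => /negbTE k0; have := key 0.
  by rewrite eqxx k0 [0 == a]eq_sym (negbTE a0); lia.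
have {}kc : k + c = a by apply/eqP; rewrite -subr_eq0 -addrA kc.
have ab0 : a + b = 0.
  apply/eqP; rewrite eq_sym; apply: contraT => /negbTE ab0; have := key 0.
  rewrite opprD !addrA kc subrr add0r eqxx ab0 !(eq_sym 0) oppr_eq0.
  by rewrite (negbTE a0) (negbTE b0).
(* The class of 1 vanishes only for [m = 0], where [a] would vanish too. *)
have c0 : c != 0.
  apply: contra_neq a0 => c0; apply/val_inj.
  by move/(congr1 val): c0; rewrite /a /=; case: (m) => [|m']; rewrite ?modn1 // modn_small.
have {}EM : S c - 1 = ((S a - 1) *m invmx M) *+ 2.
  rewrite -[LHS](mulmxK uM) [_ *m M]EM /E ab0 /S shift_mx0 !mulr2n -mulmxDl.
  by rewrite [in RHS]addrACA [in RHS]addrA.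
(* The diagonal entries of [P - 1] are -1, whereas the right side is even. *)
have /matrixP/(_ 0 0) := EM; rewrite mulmxnE !mxE add0r eq_sym (negbTE c0) eqxx.
by lia.
Qed.

End Circulant.

(** * Test sequences and the arithmetic conditions *)

Section TestSequences.
Import GRing.Theory.

Section Sparse.
Variables (G : groupType) (d : nat) (c : nat -> G).

(* [c k] at the last index of the [k]-th block of length [d] and [1] at all other
   indices; this form makes products over windows telescope. *)
Definition sparse (i : nat) : G :=
  window c (i %/ d) (i.+1 %/ d - i %/ d).

Lemma window_sparse i k :
  window sparse i k = window c (i %/ d) ((i + k) %/ d - i %/ d).
Proof.
elim: k => [|k IHk]; first by rewrite addn0 subnn !window0.
have le1 : i %/ d <= (i + k) %/ d by rewrite leq_div2r ?leq_addr.
have le2 : (i + k) %/ d <= (i + k).+1 %/ d by rewrite leq_div2r.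
rewrite windowSr IHk /sparse addnS.
have -> : (i + k).+1 %/ d - i %/ d =
    ((i + k) %/ d - i %/ d) + ((i + k).+1 %/ d - (i + k) %/ d) by lia.
by rewrite windowD subnKC.
Qed.

Hypothesis d_gt0 : 0 < d.

Lemma window_sparseM i k : window sparse i (k * d) = window c (i %/ d) k.
Proof. by rewrite window_sparse addnC divnMDl // addnK. Qed.

(** A window of length [k * d] contains the last index of exactly [k] blocks wherever it starts, so
    the relations scaled by [d] reduce to those of [c]. *)
Lemma sparse_fib_seq r m s :
  fib_seq r m s c -> fib_seq (r * d) (m * d) (s * d) sparse.
Proof.
move=> [per rel]; split=> i.
  rewrite /sparse -addSn ![(_ + m * d)%N]addnC !divnMDl // subnDl addnC.
  by rewrite (window_period _ per).
by rewrite !window_sparseM rel [in RHS]addnC divnMDl // [in RHS]addnC.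
Qed.

End Sparse.

Lemma distn_divn1 (d r s : nat) : 0 < d -> d %| r -> d %| s ->
  `|r %/ d - s %/ d|%N = 1 -> `|r - s|%N = d.
Proof.
move=> d_gt0 /dvdnP[q ->] /dvdnP[q' ->]; rewrite !mulnK // => qq'.
have [->|->] : q = q'.+1 \/ q' = q.+1 by lia.
  by rewrite mulSn; lia.
by rewrite mulSn; lia.
Qed.

Lemma free_abelian_divides (r n s : nat) : 0 < n -> 0 < r -> s <> r ->
    is_free_abelian (abelianisation (gen_fibonacci r n s)) ->
  `|r - s|%N = gcdn (gcdn r n) s /\ (n %| r \/ n %| s).
Proof.
set d := gcdn (gcdn r n) s => n_gt0 r_gt0 neq_sr free.
have dr : d %| r by rewrite /d (dvdn_trans (dvdn_gcdl _ _)) ?dvdn_gcdl.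
have dn : d %| n by rewrite /d (dvdn_trans (dvdn_gcdl _ _)) ?dvdn_gcdr.
have ds : d %| s by exact: dvdn_gcdr.
have d_gt0 : 0 < d by rewrite !gcdn_gt0 r_gt0.
have [m em] : exists m, n %/ d = m.+1.
  by exists (n %/ d).-1; rewrite prednK // divn_gt0 // dvdn_leq.
have uM : fib_mx int m (r %/ d) (s %/ d) \in unitmx.
  (* The spread-out sequence lives on H(r,n,s), so its [d]-windows vanish; the one starting at
     [i * d] is just [c i]. *)
  apply: fib_mx_unit => p p_pr c cP i.
  have := sparse_fib_seq d_gt0 cP; rewrite -em !divnK // => /free_abelian_fib_seq.
  case/(_ n_gt0 free) => _ /(_ neq_sr (i * d)).
  by rewrite -/d -[X in window _ _ X]mul1n window_sparseM // mulnK // window1.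
have := unitmx_augmentation uM; have := fib_mx_unit_dvd uM.
rewrite -em => div e; split.
  exact: distn_divn1 e.
by case: div => h; [left|right]; have := dvdn_mul h (dvdnn d); rewrite !divnK.
Qed.

Lemma free_abelian_diag (r n : nat) : 0 < n -> 0 < r ->
    is_free_abelian (abelianisation (gen_fibonacci r n r)) ->
  n %| r \/ gcdn r n = 1.
Proof.
move=> n_gt0 r_gt0 free; set d := gcdn r n.
have dr : d %| r by exact: dvdn_gcdl.
have dn : d %| n by exact: dvdn_gcdr.
have d_gt0 : 0 < d by rewrite gcdn_gt0 r_gt0.
have [d1|d_neq1] := eqVneq d 1; first by right.
have [nd|n_neqd] := eqVneq n d; first by left; rewrite {1}nd.
(* Needed for ['Z_m] to be the integers modulo [m]. *)
have m_gt1 : 1 < n %/ d.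
  by rewrite ltn_divRL // mul1n ltn_neqAle eq_sym n_neqd dvdn_leq.
set m := n %/ d in m_gt1.
pose B i : 'Z_m := if d %| i then ((i %/ d)%:R)%R else 0%R.
pose x i : Algebra.to_multiplicative 'Z_m := (B i.+1 - B i)%R.
have BD q i : B (i + q * d) = (B i + q%:R * (d %| i)%:R)%R.
  rewrite /B dvdn_addl ?dvdn_mull //; case: ifP => _; last by rewrite mulr0 addr0.
  by rewrite addnC divnMDl // mulr1 natrD addrC.
have win i k : window x i k = (B (i + k)%N - B i)%R.
  elim: k => [|k IHk]; first by rewrite addn0 subrr window0.
  rewrite windowSr IHk addnS; exact: etrans (addrC _ _) (subrKA _ _ _).
(* A shift by [n] changes [B] by 0 or [n/d], which is 0 modulo [m]. The [r]-window at [i] is [r/d]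
   or 0 according to whether [d] divides [i], which a shift by [r] preserves. *)
have xP : fib_seq r n r x.
  split=> i.
    rewrite /x -(divnK dn) -/m -addSn !BD.
    have -> : (m%:R = 0 :> 'Z_m)%R by rewrite pchar_Zp.
    by rewrite !mul0r !addr0.
  by rewrite !win -(divnK dr) !BD dvdn_addl ?dvdn_mull // [RHS]addrC !addKr addrC addKr.
(* Period [d] at index 0 would give [B(d+1) - B(d) = B(1) - B(0)]. But [B(d) = B(0) + 1], while
   [B(d+1) = B(1)] because [d] does not divide 1. *)
have [/(_ 0) + _] := free_abelian_fib_seq n_gt0 free xP.
have -> : gcdn (gcdn r n) r = d by apply/gcdn_idPl/dvdn_gcdl.
have nd1 : (d %| 1) = false by rewrite dvdn1 (negbTE d_neq1).
have Bd i : B (i + d) = (B i + (d %| i)%:R)%R by rewrite -[d in LHS]mul1n BD mul1r.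
rewrite /x -addSn !Bd nd1 dvdn0 addr0 opprD addrA => /eqP.
by rewrite addrC -subr_eq0 addrK oppr_eq0 oner_eq0.
Qed.

End TestSequences.

Theorem corollary3p3 (n r s : nat) (n_gt0 : 0 < n) (r_gt0 : 0 < r)
    (s_gt0 : 0 < s) :
  let d := gcdn (gcdn r n) s in
  let H := gen_fibonacci r n s in
  (s <> r ->
     (is_free_abelian (abelianisation H) <->
        `|r - s|%N = d /\ (n %| r \/ n %| s)) /\
     (`|r - s|%N = d /\ (n %| r \/ n %| s) -> free_of_rank H d.-1))
  /\
  (s = r ->
     (is_free_abelian (abelianisation H) <-> n %| r \/ d = 1) /\
     (n %| r -> free_of_rank H n) /\
     (d = 1 -> isomorphic H (torus_knot_group r n))).
Proof.
move=> d H; have dn : d %| n by rewrite /d (dvdn_trans (dvdn_gcdl _ _)) ?dvdn_gcdr.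
have d_gt0 : 0 < d by rewrite !gcdn_gt0 r_gt0.
split=> [neq_sr | eq_sr].
  have free : `|r - s|%N = d /\ (n %| r \/ n %| s) -> free_of_rank H d.-1.
    by case; exact: gen_fibonacci_free.
  split=> //; split=> [|/free]; last exact: free_of_rank_ab.
  exact: free_abelian_divides.
have dE : d = gcdn r n by rewrite /d eq_sr; apply/gcdn_idPl/dvdn_gcdl.
rewrite dE /H eq_sr; split; last split.
- split=> [|[nr|rn]]; first exact: free_abelian_diag.
    exact/free_of_rank_ab/gen_fibonacci_free_diag.
  by apply: gen_fibonacci_ab_coprime => //; apply/eqP.
- exact: gen_fibonacci_free_diag.
- by move=> rn; apply: gen_fibonacci_torus => //; apply/eqP.
Qed.
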